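(* Let $k$ be a field, $A$ a commutative $k$-algebra, $X_\bullet$ a pointed simplicial set with each $X_n$ finite, and $M$ a $k$-vector space equipped with a family of pairwise commuting $A$-module structures $\Lambda^{\sigma}_{(i,n)}$, one for each $n\ge 0$, each $\sigma\in X_{n+1}$ with $\sigma\neq\ast$, and each $0\le i\le n+1$ with $d_i(\sigma)=\ast$. Suppose that the following conditions hold for all $n\ge 0$, all $\sigma\in X_{n+2}$ with $\sigma\neq\ast$, and all $0\le i<j\le n+2$: (i) (sweep around) if $d_i(\sigma)=d_j(\sigma)=\ast$, then $\Lambda^{\sigma}_{(j,n+1)}=\Lambda^{\sigma}_{(i,n+1)}$; (ii) (sweep out 1) if $d_i(\sigma)=\Omega\neq\ast$, $d_j(\sigma)=\ast$ and $d_{j-1}(\Omega)=\ast$, then $\Lambda^{\sigma}_{(j,n+1)}=\Lambda^{\Omega}_{(j-1,n)}$; (iii) (sweep across) if $d_j(\sigma)=\Omega\neq\ast$, $d_i(\sigma)=\mu\neq\ast$, $d_i(\Omega)=\ast$ and $d_{j-1}(\mu)=\ast$, then $\Lambda^{\Omega}_{(i,n)}=\Lambda^{\mu}_{(j-1,n)}$; (iv) (sweep out 2) if $d_i(\sigma)=\ast$, $d_j(\sigma)=\Omega\neq\ast$ and $d_i(\Omega)=\ast$, then $\Lambda^{\Omega}_{(i,n)}=\Lambda^{\sigma}_{(i,n+1)}$. Then the $k$-vector spaces $$(M,X)^n=\operatorname{Hom}_k\Big(k\otimes_k\bigotimes_{\sigma\in X_n,\ \sigma\neq\ast}A,\ M\Big),\qquad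 n\ge 0,$$ together with the coface maps $d^i_n\colon (M,X)^n\to (M,X)^{n+1}$ ($0\le i\le n+1$) given by $$(d^i_nf)\Big(1\otimes_k\bigotimes_{\sigma\in X_{n+1},\ \sigma\neq\ast}a_\sigma\Big)=\prod_{\sigma\in X_{n+1},\ \sigma\neq\ast,\ d_i(\sigma)=\ast}\Lambda^{\sigma}_{(i,n)}(a_\sigma)\cdot f\Big(1\otimes_k\bigotimes_{\Omega\in X_n,\ \Omega\neq\ast}\ \prod_{\sigma\in X_{n+1},\ d_i(\sigma)=\Omega}a_\sigma\Big)$$ and the codegeneracy maps $s^i_n\colon (M,X)^{n+1}\to (M,X)^n$ ($0\le i\le n$) given by $$(s^i_nf)\Big(1\otimes_k\bigotimes_{\sigma\in X_n,\ \sigma\neq\ast}a_\sigma\Big)=f\Big(1\otimes_k\bigotimes_{\Omega\in X_{n+1},\ \Omega\neq\ast}\ 1\cdot\prod_{\sigma\in X_n,\ s_i(\sigma)=\Omega}a_\sigma\Big)$$ form a cosimplicial $k$-vector space $(M,X)^\bullet$.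
   Context: For a pointed simplicial set $X_\bullet$ with face maps $d_i$ and degeneracy maps $s_i$, the symbol $\ast$ denotes the base point of $X_n$ for each $n$ (the base vertex and its iterated degeneracies); it is preserved by all $d_i$ and $s_i$. The factor $k$ in $k\otimes_k\bigotimes A$ corresponds to the base point. All $A$-module structures on $M$ are unital and compatible with the given $k$-vector space structure, so each $\Lambda^{\sigma}_{(i,n)}$ is a $k$-algebra homomorphism $A\to\operatorname{End}_k(M)$, and $\Lambda^{\sigma}_{(i,n)}(a)$ denotes the corresponding action of $a\in A$ on $M$. Pairwise commuting means that $\Lambda(a)\Lambda'(b)=\Lambda'(b)\Lambda(a)$ for any two of the actions $\Lambda,\Lambda'$ and all $a,b\in A$; different actions are allowed to be equal or different. A product of actions denotes their composition in $\operatorname{End}_k(M)$, and empty products (in $A$ or in $\operatorname{End}_k(M)$) are the identity. The maps $d^i_n f$ and $s^i_n f$ are extended $k$-linearly from the indicated elements. A cosimplicial $k$-vector space is a family of $k$-vector spaces with linear coface and codegeneracy maps satisfying the cosimplicial identities: $d^jd^i=d^id^{j-1}$ for $i<j$; $s^js^i=s^{i-1}s^j$ for $i>j$; $s^jd^i=d^is^{j-1}$ for $i<j$, $s^jd^i=\mathrm{id}$ for $i=j,j+1$, and $s^jd^i=d^{i-1}s^j$ for $i>j+1$. *)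

(* Defs.v *)
From HB Require Import structures.
From mathcomp Require Import all_boot all_algebra boolp.
From mathcomp.multinomials Require Import freeg.

Set Implicit Arguments.
Unset Strict Implicit.
Unset Printing Implicit Defensive.

Import GRing.Theory.

Local Open Scope ring_scope.
Local Open Scope quotient_scope.

Section Tensor.
Variables (k : fieldType) (U V : lmodType k) (I : finType).

Definition upd (v : {ffun I -> V}) (i : I) (x : V) : {ffun I -> V} :=
  [ffun j => if j == i then x else v j].

Definition multilinear (W : lmodType k) (phi : U -> {ffun I -> V} -> W) : Prop :=
  (forall v, linear (phi^~ v)) /\
  (forall u v i, linear (fun x => phi u (upd v i x))).

Local Notation free := {freeg (U * {ffun I -> V})%type / k}.

Local Notation gen u v := (<< (u, v) >> : free).

Inductive tensor_null : free -> Prop :=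
| Tensor_null0 : tensor_null 0
| Tensor_nullZD c x y :
    tensor_null x -> tensor_null y -> tensor_null (c *: x + y)
| Tensor_nulll c u u' v :
    tensor_null (gen (c *: u + u') v - (c *: gen u v + gen u' v))
| Tensor_nullr c u v i x y :
    tensor_null (gen u (upd v i (c *: x + y))
                 - (c *: gen u (upd v i x) + gen u (upd v i y))).

Definition tensor_null_pred : {pred free} := fun x => `[< tensor_null x >].

Fact tensor_null_submod : submod_closed tensor_null_pred.
Proof.
split=> [|c x y /asboolP nx /asboolP ny]; apply/asboolP.
  exact: Tensor_null0.
exact: Tensor_nullZD.
Qed.

HB.instance Definition _ :=
  GRing.isSubmodClosed.Build k free tensor_null_pred tensor_null_submod.

Local Notation tquot := (Quotient.quot tensor_null_pred).

(* The tensor product over k of U and of copies of V indexed by I: the free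
   vector space on U x V^I modulo the multilinearity relations. *)
Definition tensor : Type := tquot.

HB.instance Definition _ := GRing.Zmodule.on tensor.

Definition tensor_pi (x : free) : tensor := \pi_tquot x.
Definition tensor_repr (t : tensor) : free :=
  repr (t : tquot).

Fact tensor_reprK : cancel tensor_repr tensor_pi.
Proof. exact: reprK. Qed.

Fact tensor_piB : {morph tensor_pi : x y / x - y}.
Proof. by move=> x y; rewrite /tensor_pi raddfB. Qed.

Fact tensor_piD : {morph tensor_pi : x y / x + y}.
Proof. by move=> x y; rewrite /tensor_pi raddfD. Qed.

Fact tensor_pi_eq x y : tensor_pi x = tensor_pi y <-> tensor_null (x - y).
Proof.
rewrite /tensor_pi; split=> [e|h].
  by apply/asboolP; have /eqP := e; rewrite -Quotient.idealrBE.
by apply/eqP; rewrite -Quotient.idealrBE; apply/asboolP.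
Qed.

Fact tensor_nullZ c x : tensor_null x -> tensor_null (c *: x).
Proof.
by move=> nx; rewrite -[_ *: _]addr0; apply: Tensor_nullZD (Tensor_null0).
Qed.

Definition tensor_scale (c : k) (t : tensor) : tensor :=
  tensor_pi (c *: tensor_repr t).

Fact tensor_pi_scale c x : tensor_pi (c *: x) = tensor_scale c (tensor_pi x).
Proof.
apply/tensor_pi_eq; rewrite -scalerBr; apply/tensor_nullZ/tensor_pi_eq.
by rewrite tensor_reprK.
Qed.

Fact tensor_scaleA a b t :
  tensor_scale a (tensor_scale b t) = tensor_scale (a * b) t.
Proof. by rewrite -[t]tensor_reprK -!tensor_pi_scale scalerA. Qed.

Fact tensor_scale1 : left_id 1 tensor_scale.
Proof. by move=> t; rewrite -[t]tensor_reprK -!tensor_pi_scale scale1r. Qed.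

Fact tensor_scaleDr : right_distributive tensor_scale +%R.
Proof.
move=> c t t'; rewrite -[t]tensor_reprK -[t']tensor_reprK.
by rewrite -tensor_piD -!tensor_pi_scale -tensor_piD scalerDr.
Qed.

Fact tensor_scaleDl t : {morph tensor_scale^~ t : a b / a + b}.
Proof.
move=> a b; rewrite -[t]tensor_reprK.
by rewrite -!tensor_pi_scale -tensor_piD scalerDl.
Qed.

HB.instance Definition _ := GRing.Zmodule_isLmodule.Build k tensor
  tensor_scaleA tensor_scale1 tensor_scaleDr tensor_scaleDl.

Fact tensor_piZ c x : tensor_pi (c *: x) = c *: tensor_pi x.
Proof. exact: tensor_pi_scale. Qed.

Definition pure (u : U) (v : {ffun I -> V}) : tensor := tensor_pi (gen u v).

Lemma pure_multilinear : multilinear pure.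
Proof.
split=> [v c u u'|u v i c x y].
  rewrite /pure -tensor_piZ -tensor_piD; apply/tensor_pi_eq.
  exact: Tensor_nulll.
rewrite /pure -tensor_piZ -tensor_piD; apply/tensor_pi_eq.
exact: Tensor_nullr.
Qed.

Lemma tensor_ind (P : tensor -> Prop) :
  P 0 -> (forall c u v t, P t -> P (c *: pure u v + t)) -> forall t, P t.
Proof.
move=> P0 PD t; rewrite -[t]tensor_reprK -[tensor_repr t]freeg_sumE.
elim: (dom _) => [|[u v] s IH]; first by rewrite big_nil /tensor_pi raddf0.
rewrite big_cons tensor_piD.
set c := coeff _ _; have -> : << c *g (u, v) >> = c *: gen u v.
  by apply/eqP/freeg_eqP => z; rewrite coeffZ !coeffU mul1r.
by rewrite tensor_piZ; apply: PD.
Qed.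

Lemma tensor_ext (W : lmodType k) (f g : {linear tensor -> W}) :
  (forall u v, f (pure u v) = g (pure u v)) -> f =1 g.
Proof.
move=> fg; apply: tensor_ind => [|c u v t IH]; first by rewrite !linear0.
by rewrite !linearP IH fg.
Qed.

Section Lift.
Variables (W : lmodType k) (phi : U -> {ffun I -> V} -> W).
Hypothesis phi_ml : multilinear phi.

Let psi := fglift (fun p : U * {ffun I -> V} => phi p.1 p.2).

Let psi_lin : linear psi.
Proof.
have addpsi (x y : free) : psi (x + y) = psi x + psi y.
  have psiB := lift_is_additive (fun p : U * {ffun I -> V} => phi p.1 p.2).
  have psi0 : psi 0 = 0 by rewrite -[0 in LHS](subrr 0) [LHS]psiB subrr.
  have psiN z : psi (- z) = - psi z by rewrite -sub0r [LHS]psiB -/psi psi0 sub0r.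
  by rewrite -{1}[y]opprK [LHS]psiB -/psi psiN opprK.
have psi0 : psi 0 = 0.
  by apply: (addrI (psi 0)); rewrite -addpsi !addr0.
have psis (T : Type) (s : seq T) (F : T -> free) :
    psi (\sum_(z <- s) F z) = \sum_(z <- s) psi (F z).
  by elim: s => [|z s IH]; rewrite ?big_nil ?big_cons ?addpsi ?IH.
move=> c x y; rewrite addpsi; congr (_ + _).
rewrite -{2}[x]freeg_sumE [c *: x]/(fgscale c x) /fgscale !psis scaler_sumr.
by apply: eq_bigr => z _; rewrite /psi !liftU scalerA.
Qed.

Let psi_null x : tensor_null x -> psi x = 0.
Proof.
have psiB a b : psi (a - b) = psi a - psi b.
  exact: lift_is_additive.
have psi0 : psi 0 = 0 by rewrite -[0 in LHS](subrr 0) psiB subrr.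
have psiZ c a : psi (c *: a) = c *: psi a.
  by rewrite -[_ *: a]addr0 psi_lin psi0 addr0.
have [phil phir] := phi_ml.
have psig u v : psi (gen u v) = phi u v by rewrite /psi liftU scale1r.
elim=> // [c a b _ ha _ hb|c u u' v|c u v i a b].
- by rewrite psi_lin ha hb scaler0 addr0.
- by rewrite psiB psi_lin !psig phil subrr.
- by rewrite psiB psi_lin !psig phir subrr.
Qed.

Definition tensor_lift_fun (t : tensor) : W := psi (tensor_repr t).

Let lift_pi x : tensor_lift_fun (tensor_pi x) = psi x.
Proof.
apply/eqP; rewrite -subr_eq0; apply/eqP.
have psiB a b : psi (a - b) = psi a - psi b by exact: lift_is_additive.
rewrite -psiB; apply/psi_null/tensor_pi_eq; exact: tensor_reprK.
Qed.

Fact tensor_lift_linear : linear tensor_lift_fun.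
Proof.
move=> c t t'; rewrite -[t]tensor_reprK -[t']tensor_reprK.
by rewrite -tensor_piZ -tensor_piD !lift_pi psi_lin.
Qed.

HB.instance Definition _ :=
  GRing.isLinear.Build k tensor W *:%R tensor_lift_fun tensor_lift_linear.

Definition tensor_lift : {linear tensor -> W} := tensor_lift_fun.

Lemma tensor_liftE u v : tensor_lift (pure u v) = phi u v.
Proof. by rewrite [LHS]lift_pi /psi liftU scale1r. Qed.

End Lift.
End Tensor.

Section Hom.
Variables (k : fieldType) (U V : lmodType k).

Definition Hom : Type := {linear U -> V}.

Definition linear_of_Hom (f : Hom) : {linear U -> V} := f.
Coercion linear_of_Hom : Hom >-> GRing.Linear.type.

Lemma Hom_ext (f g : Hom) : f =1 g -> f = g.
Proof.
case: f => f [a b]; case: g => g [a' b'] /= /funext e.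
case: _ / e a' b' => a' b'.
case: a a' b b' => [a] [a'] [b] [b'].
by rewrite (Prop_irrelevance a a') (Prop_irrelevance b b').
Qed.

HB.instance Definition _ := gen_eqMixin Hom.
HB.instance Definition _ := gen_choiceMixin Hom.

Definition Hom_zero : Hom := \0%R : {linear U -> V}.
Definition Hom_add (f g : Hom) : Hom := (f \+ g : {linear U -> V}).
Definition Hom_opp (f : Hom) : Hom := (\- f : {linear U -> V}).
Definition Hom_scale (c : k) (f : Hom) : Hom := (c \*: f : {linear U -> V}).

Fact Hom_addA : associative Hom_add.
Proof. by move=> f g h; apply: Hom_ext => x /=; rewrite addrA. Qed.
Fact Hom_addC : commutative Hom_add.
Proof. by move=> f g; apply: Hom_ext => x /=; rewrite addrC. Qed.
Fact Hom_add0 : left_id Hom_zero Hom_add.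
Proof. by move=> f; apply: Hom_ext => x /=; rewrite add0r. Qed.
Fact Hom_addN : left_inverse Hom_zero Hom_opp Hom_add.
Proof. by move=> f; apply: Hom_ext => x /=; rewrite addNr. Qed.

HB.instance Definition _ :=
  GRing.isZmodule.Build Hom Hom_addA Hom_addC Hom_add0 Hom_addN.

Fact Hom_scaleA a b f : Hom_scale a (Hom_scale b f) = Hom_scale (a * b) f.
Proof. by apply: Hom_ext => x /=; rewrite scalerA. Qed.
Fact Hom_scale1 : left_id 1 Hom_scale.
Proof. by move=> f; apply: Hom_ext => x /=; rewrite scale1r. Qed.
Fact Hom_scaleDr : right_distributive Hom_scale +%R.
Proof. by move=> c f g; apply: Hom_ext => x /=; rewrite scalerDr. Qed.
Fact Hom_scaleDl f : {morph Hom_scale^~ f : a b / a + b}.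
Proof. by move=> a b; apply: Hom_ext => x /=; rewrite scalerDl. Qed.

HB.instance Definition _ := GRing.Zmodule_isLmodule.Build k Hom
  Hom_scaleA Hom_scale1 Hom_scaleDr Hom_scaleDl.

Lemma Hom_linE c (f g : Hom) x : (c *: f + g) x = c *: f x + g x.
Proof. by []. Qed.

End Hom.

(* A commutative k-algebra is a commutative ring A with a ring morphism from k
   to A. This allows the zero algebra, which comAlgType excludes. *)
Definition alg_space (k : fieldType) (A : comPzRingType)
  (eta : {rmorphism k -> A}) : Type := A.

Section AlgSpace.
Variables (k : fieldType) (A : comPzRingType) (eta : {rmorphism k -> A}).
Local Notation AS := (alg_space eta).

HB.instance Definition _ := GRing.ComPzRing.on AS.

Definition alg_scale (c : k) (a : AS) : AS := eta c * a.

Fact alg_scaleA a b v : alg_scale a (alg_scale b v) = alg_scale (a * b) v.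
Proof. by rewrite /alg_scale rmorphM mulrA. Qed.
Fact alg_scale1 : left_id 1 alg_scale.
Proof. by move=> v; rewrite /alg_scale rmorph1 mul1r. Qed.
Fact alg_scaleDr : right_distributive alg_scale +%R.
Proof. by move=> c v w; rewrite /alg_scale mulrDr. Qed.
Fact alg_scaleDl v : {morph alg_scale^~ v : a b / a + b}.
Proof. by move=> a b; rewrite /alg_scale rmorphD mulrDl. Qed.

HB.instance Definition _ := GRing.Zmodule_isLmodule.Build k AS
  alg_scaleA alg_scale1 alg_scaleDr alg_scaleDl.

Lemma alg_scaleE (c : k) (a : AS) : c *: a = eta c * a.
Proof. by []. Qed.

(* The A-module structures on M that induce its given k-space structure. *)
Record module_structure (M : lmodType k) := ModuleStructure {
  mod_act :> A -> M -> M;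
  mod_actA : forall a b m, mod_act a (mod_act b m) = mod_act (a * b) m;
  mod_act1 : forall m, mod_act 1 m = m;
  mod_actDr : forall a m m', mod_act a (m + m') = mod_act a m + mod_act a m';
  mod_actDl : forall a b m, mod_act (a + b) m = mod_act a m + mod_act b m;
  mod_act_scalar : forall c m, mod_act (eta c) m = c *: m
}.

Section Act.
Variables (M : lmodType k) (S : module_structure M).

Lemma mod_act_linear (a : A) : linear (S a).
Proof. by move=> c m m'; rewrite mod_actDr -!(mod_act_scalar S) !mod_actA mulrC. Qed.

Lemma mod_act_linearl (c : k) (a b : AS) m :
  S (c *: a + b) m = c *: S a m + S b m.
Proof. by rewrite mod_actDl alg_scaleE -mod_actA mod_act_scalar. Qed.

End Act.
End AlgSpace.

(* Pointed simplicial sets with finite sets of simplices, i.e., simplicial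
   objects in pointed finite sets. In the identities, inord only changes the
   type of an index, whose value is always within bounds. *)
Record pointed_fin_sset := PointedFinSSet {
  cells :> nat -> finType;
  face : forall n, 'I_n.+2 -> cells n.+1 -> cells n;
  degen : forall n, 'I_n.+1 -> cells n -> cells n.+1;
  basept : forall n, cells n;
  face_face : forall n (i j : 'I_n.+3) (x : cells n.+2), (i < j)%N ->
    face (inord i) (face j x) = face (inord j.-1) (face i x);
  face_degen_lt : forall n (i : 'I_n.+3) (j : 'I_n.+2) (x : cells n.+1),
    (i < j)%N -> face i (degen j x) = degen (inord j.-1) (face (inord i) x);
  face_degen_id : forall n (i : 'I_n.+2) (j : 'I_n.+1) (x : cells n),
    i = j :> nat \/ i = j.+1 :> nat -> face i (degen j x) = x;
  face_degen_gt : forall n (i : 'I_n.+3) (j : 'I_n.+2) (x : cells n.+1),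
    (j.+1 < i)%N -> face i (degen j x) = degen (inord j) (face (inord i.-1) x);
  degen_degen : forall n (i j : 'I_n.+1) (x : cells n), (i <= j)%N ->
    degen (inord i) (degen j x) = degen (inord j.+1) (degen i x);
  face_basept : forall n (i : 'I_n.+2), face i (basept n.+1) = basept n;
  degen_basept : forall n (i : 'I_n.+1), degen i (basept n) = basept n.+1
}.

Record is_cosimplicial (k : fieldType) (C : nat -> lmodType k)
    (d : forall n, 'I_n.+2 -> C n -> C n.+1)
    (s : forall n, 'I_n.+1 -> C n.+1 -> C n) : Prop := IsCosimplicial {
  coface_linear : forall n i, linear (d n i);
  codegen_linear : forall n i, linear (s n i);
  coface_coface : forall n (i j : 'I_n.+3) (f : C n), (i < j)%N ->
    d n.+1 j (d n (inord i) f) = d n.+1 i (d n (inord j.-1) f);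
  codegen_codegen : forall n (i j : 'I_n.+2) (f : C n.+2), (j < i)%N ->
    s n (inord j) (s n.+1 i f) = s n (inord i.-1) (s n.+1 j f);
  codegen_coface_lt : forall n (i : 'I_n.+3) (j : 'I_n.+2) (f : C n.+1),
    (i < j)%N -> s n.+1 j (d n.+1 i f) = d n (inord i) (s n (inord j.-1) f);
  codegen_coface_id : forall n (i : 'I_n.+2) (j : 'I_n.+1) (f : C n),
    i = j :> nat \/ i = j.+1 :> nat -> s n j (d n i f) = f;
  codegen_coface_gt : forall n (i : 'I_n.+3) (j : 'I_n.+2) (f : C n.+1),
    (j.+1 < i)%N -> s n.+1 j (d n.+1 i f) = d n (inord i.-1) (s n (inord j) f)
}.

Notation nbcell X n := {x : cells X n | x != basept X n}.

Section Complex.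
Variables (k : fieldType) (A : comPzRingType) (eta : {rmorphism k -> A}).
Variables (X : pointed_fin_sset) (M : lmodType k).
Local Notation AS := (alg_space eta).

(* k (x) A (x) ... (x) A, with one factor A for each simplex of X_n other than
   the base point. *)
Definition tensorX (n : nat) : lmodType k := tensor k^o AS (nbcell X n).

Definition pureX n (a : {ffun nbcell X n -> AS}) : tensorX n := pure (1 : k^o) a.

(* The space (M, X)^n. *)
Definition MX (n : nat) : lmodType k := Hom (tensorX n) M.

(* When p preserves the base point, the fibre of p over y != * avoids it, so
   restricting the product to x != * loses no factor. *)
Definition push (m n : nat) (p : X m -> X n) (a : {ffun nbcell X m -> AS}) :
    {ffun nbcell X n -> AS} :=
  [ffun y : nbcell X n => \prod_(x : nbcell X m | p (val x) == val y) a x].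

Lemma push_upd_base m n (p : X m -> X n) a x0 z :
  p (val x0) = basept X n -> push p (upd a x0 z) = push p a.
Proof.
move=> px0; apply/ffunP => y; rewrite !ffunE; apply: eq_bigr => x /eqP px.
rewrite ffunE; case: eqP => // xx0.
by have := valP y; rewrite -px xx0 px0 eqxx.
Qed.

Lemma push_upd m n (p : X m -> X n) a x0 (y0 : nbcell X n) z :
  p (val x0) = val y0 ->
  push p (upd a x0 z) =
    upd (push p a) y0 (z * \prod_(x | (p (val x) == val y0) && (x != x0)) a x).
Proof.
move=> px0; apply/ffunP => y; rewrite !ffunE; case: (eqVneq y y0) => [->|ny].
  rewrite (bigD1 x0) ?px0 //= ffunE eqxx; congr (_ * _).
  by apply: eq_bigr => x /andP[_ nx]; rewrite ffunE (negPf nx).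
apply: eq_bigr => x /eqP px; rewrite ffunE; case: eqP => // xx0.
by move: ny; rewrite -(inj_eq val_inj) -px xx0 px0 eqxx.
Qed.

Lemma pure_upd_push n c (a : {ffun nbcell X n -> AS}) y0 (r : AS) :
  linear (fun z : AS => pure c (upd a y0 (z * r)) : tensorX n).
Proof.
move=> e z z'; rewrite -(pure_multilinear _ _ _).2 /=.
by congr (pure c (upd a y0 _)); rewrite mulrDl !alg_scaleE mulrA.
Qed.

Variable L : forall n (i : 'I_n.+2) (x : nbcell X n.+1),
  face i (val x) = basept X n -> module_structure eta M.

(* The composite, over all x != * with d_i x = *, of the actions of the a_x; its
   order is immaterial when the module structures commute. *)
Definition act_prod n (i : 'I_n.+2) (a : {ffun nbcell X n.+1 -> AS}) : M -> M :=
  \big[comp/id]_(x : {x : nbcell X n.+1 | face i (val x) == basept X n})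
    L (eqP (valP x)) (a (val x)).

Definition coface_fun n (i : 'I_n.+2) (f : MX n)
    (c : k^o) (a : {ffun nbcell X n.+1 -> AS}) : M :=
  c *: act_prod i a (f (pureX (push (face i) a))).

Section ActProd.
Variables (n : nat) (i : 'I_n.+2) (a : {ffun nbcell X n.+1 -> AS}).
Local Notation J := {x : nbcell X n.+1 | face i (val x) == basept X n}.
Implicit Type s : seq J.

Let ap s (b : {ffun nbcell X n.+1 -> AS}) : M -> M :=
  \big[comp/id]_(x <- s) L (eqP (valP x)) (b (val x)).

Let ap_linear s b : linear (ap s b).
Proof.
move=> c m m'; rewrite /ap; elim: s => [|x s IH]; rewrite ?big_nil //.
by rewrite big_cons /= IH mod_act_linear.
Qed.

Lemma act_prod_linear : linear (act_prod i a).
Proof. exact: ap_linear. Qed.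

Let ap_upd_notin s x0 z : x0 \notin map val s -> ap s (upd a x0 z) = ap s a.
Proof.
rewrite /ap; elim: s => [|x s IH]; first by rewrite !big_nil.
rewrite inE negb_or !big_cons => /andP[nx /IH ->].
by rewrite ffunE (_ : (val x == x0) = false) // eq_sym (negPf nx).
Qed.

Lemma act_prod_upd_notin x0 z :
  face i (val x0) != basept X n -> act_prod i (upd a x0 z) = act_prod i a.
Proof.
move=> nx0; apply: ap_upd_notin; apply/mapP => -[x _ ex].
by have := valP x; rewrite -ex (negPf nx0).
Qed.

Lemma act_prod_upd x0 m : face i (val x0) = basept X n ->
  linear (fun z : AS => act_prod i (upd a x0 z) m).
Proof.
move=> px0 c z z'; pose t0 : J := Sub x0 (introT eqP px0).
have: t0 \in index_enum J by rewrite mem_index_enum.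
rewrite /act_prod; elim: (index_enum J) (index_enum_uniq J) => // x s IH.
rewrite /= inE => /andP[nx us]; rewrite !big_cons /=.
case: (eqVneq x t0) => [ext _|nxt /= t0s].
  have nx0 : x0 \notin map val s.
    by apply/mapP => -[y ys ey]; move: nx; rewrite ext (_ : t0 = y) ?ys //;
       apply: val_inj.
  rewrite -!/(ap s _) !(ap_upd_notin _ nx0) !ffunE ext /= eqxx.
  exact: mod_act_linearl.
have nv : val x != x0 by rewrite -[x0]/(val t0) (inj_eq val_inj).
rewrite !ffunE (negPf nv) IH ?mod_act_linear //.
Qed.

End ActProd.

Fact coface_multilinear n (i : 'I_n.+2) (f : MX n) :
  multilinear (coface_fun i f).
Proof.
split=> [a c u u'|u a x0 c z z']; rewrite /coface_fun.
  by rewrite scalerDl scalerA.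
have -> : c *: (u *: act_prod i (upd a x0 z)
                  (f (pureX (push (face i) (upd a x0 z)))))
    = u *: (c *: act_prod i (upd a x0 z)
                  (f (pureX (push (face i) (upd a x0 z))))).
  by rewrite !scalerA [X in X *: _]mulrC.
rewrite -scalerDr; congr (_ *: _).
have [px0|nx0] := eqVneq (face i (val x0)) (basept X n).
  by rewrite !(push_upd_base _ _ px0) act_prod_upd.
rewrite !act_prod_upd_notin //.
pose y0 : nbcell X n := exist (fun y => y != basept X n) _ nx0.
rewrite !(@push_upd _ _ (face i) a x0 y0 _ (erefl _)).
by rewrite /pureX pure_upd_push linearP act_prod_linear.
Qed.

Definition coface n (i : 'I_n.+2) (f : MX n) : MX n.+1 :=
  tensor_lift (coface_multilinear i f).

Lemma cofaceE n (i : 'I_n.+2) (f : MX n) a :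
  coface i f (pureX a) = act_prod i a (f (pureX (push (face i) a))).
Proof. by rewrite [LHS]tensor_liftE /coface_fun scale1r. Qed.

Definition codegen_fun n (i : 'I_n.+1) (f : MX n.+1)
    (c : k^o) (a : {ffun nbcell X n -> AS}) : M :=
  c *: f (pureX (push (degen i) a)).

Fact degen_nbcell n (i : 'I_n.+1) (x : nbcell X n) :
  degen i (val x) != basept X n.+1.
Proof.
apply/eqP => e; have := valP x => /eqP; apply.
pose j : 'I_n.+2 := inord i.
have ij : j = i :> nat by rewrite inordK // ltnS ltnW.
rewrite -[val x](@face_degen_id X n j i) ?e ?face_basept //.
by left.
Qed.

Fact codegen_multilinear n (i : 'I_n.+1) (f : MX n.+1) :
  multilinear (codegen_fun i f).
Proof.
split=> [a c u u'|u a x0 c z z']; rewrite /codegen_fun.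
  by rewrite scalerDl scalerA.
pose y0 : nbcell X n.+1 := 
  exist (fun y => y != basept X n.+1) _ (degen_nbcell i x0).
rewrite !(@push_upd _ _ (degen i) a x0 y0 _ (erefl _)).
rewrite /pureX pure_upd_push linearP scalerDr; congr (_ + _).
by rewrite !scalerA [X in X *: _]mulrC.
Qed.

Definition codegen n (i : 'I_n.+1) (f : MX n.+1) : MX n :=
  tensor_lift (codegen_multilinear i f).

Lemma codegenE n (i : 'I_n.+1) (f : MX n.+1) a :
  codegen i f (pureX a) = f (pureX (push (degen i) a)).
Proof. by rewrite [LHS]tensor_liftE /codegen_fun scale1r. Qed.

Lemma MX_ext n (f g : MX n) : (forall a, f (pureX a) = g (pureX a)) -> f = g.
Proof.
move=> fg; apply/Hom_ext/tensor_ext => u v.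
have -> : pure u v = u *: pureX v :> tensorX n.
  have [phil _] := pure_multilinear k^o AS (nbcell X n).
  have e0 : pure (0 : k^o) v = 0 :> tensorX n.
    have := phil v (-1) 0 0; rewrite scaler0 addr0 scaleN1r => e.
    by rewrite [LHS]e addNr.
  have := phil v u 1 0; rewrite e0 !addr0 => <-.
  by rewrite -[u *: 1]/(u * 1) mulr1.
by rewrite !linearZ fg.
Qed.

End Complex.

(* Main.v *)
From HB Require Import structures.
Require Import Defs.
From mathcomp Require Import all_boot all_algebra boolp.

Set Implicit Arguments.
Unset Strict Implicit.
Unset Printing Implicit Defensive.

Import GRing.Theory.

Local Open Scope ring_scope.

(** Every operator [d] or [s] precomposes a functional with the push-forward of
    labels along a simplicial operator of [X], and a coface moreover applies one
    action for each simplex that the face operator sends to the base point.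
    Push-forward is functorial on base-point-preserving maps ([push_comp],
    [push_id]), so the simplicial identities of [X] take care of the
    precomposed part of every cosimplicial identity.

    It remains to compare the actions, and this can be done one label at a time.
    Since the module structures are multiplicative, the actions that [d^i]
    performs on labels pushed along [p] form the product, over all simplices [x],
    of one operator that depends only on [p x] and on the label of [x]
    ([act_prod_push]).  On the two sides of [d^j d^i = d^i d^(j-1)], with
    [i < j], the simplex [x] contributes according to which of the
    faces [d_i x], [d_j x] are the base point; sweep around is the
    case where both are, sweep out 1 and sweep out 2 are the cases where one of
    them is, and sweep across is the case where neither is but their common
    face [d_i d_j x = d_(j-1) d_i x] is ([act_sweep]).  In the mixed identities
    for [s^j d^i] one must know that the action attached to [s_j x] is the one
    attached to [x]; this is sweep out applied to the simplex [s_j x], which has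
    [x] as its [j]-th face ([act_degen_lt], [act_degen_gt]).  If [i = j] or
    [i = j + 1] then no action occurs: [d_i s_j x = x], so [d_i] sends [s_j x] to
    the base point only if [x] is the base point, which carries no label.

    These products of operators must be reordered and regrouped.  All actions
    lie in the bicommutant of the set of actions, which is a commutative monoid
    because the actions commute, so the general theory of iterated commutative
    operators applies there. *)

(** * Bicommutants *)

Record commuting_set (T : Type) := CommutingSet {
  in_commuting :> (T -> T) -> Prop;
  commutingC : forall f g, in_commuting f -> in_commuting g ->
    f \o g = g \o f
}.

Section Bicommutant.
Variables (T : Type) (S : commuting_set T).

Definition centralizes (P : (T -> T) -> Prop) (f : T -> T) : Prop :=
  forall g, P g -> f \o g = g \o f.

Record bicommutant := Bicommutant {
  bival :> T -> T;
  bivalP : centralizes (centralizes S) bival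
}.

Lemma bival_inj (f g : bicommutant) : bival f = bival g -> f = g.
Proof.
case: f g => f fP [g gP] /= efg; case: _ / efg gP => gP.
by rewrite (Prop_irrelevance fP gP).
Qed.

Fact bi1_subproof : centralizes (centralizes S) id.
Proof. by []. Qed.

Definition bi1 : bicommutant := Bicommutant bi1_subproof.

Fact bimul_subproof (f g : bicommutant) : centralizes (centralizes S) (f \o g).
Proof.
move=> h hS; rewrite -compA (bivalP g hS) compA (bivalP f hS).
by rewrite -compA.
Qed.

Definition bimul (f g : bicommutant) : bicommutant :=
  Bicommutant (bimul_subproof f g).

Fact bimulA : associative bimul.
Proof. by move=> f g h; apply: bival_inj. Qed.

(** As [S] is commuting it lies in its own centralizer, so the bicommutant of
    [S] centralizes [S]; hence its elements, which centralize whatever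
    centralizes [S], centralize each other. *)
Fact bimulC : commutative bimul.
Proof.
move=> f g; have gS : centralizes S g.
  move=> h Sh; have hS : centralizes S h
    by move=> h' Sh'; apply: commutingC Sh Sh'.
  exact: bivalP hS.
exact/bival_inj/(bivalP f gS).
Qed.

Fact bimul1 : left_id bi1 bimul.
Proof. by move=> f; apply: bival_inj. Qed.

HB.instance Definition _ := Monoid.isComLaw.Build bicommutant bi1 bimul
  bimulA bimulC bimul1.

Fact in_bicommutant f : S f -> centralizes (centralizes S) f.
Proof. by move=> Sf g gS; rewrite gS. Qed.

Lemma bival_prod (I : Type) (r : seq I) (P : pred I) (F : I -> bicommutant) :
  bival (\big[bimul/bi1]_(x <- r | P x) F x) =
    \big[comp/id]_(x <- r | P x) bival (F x).
Proof. exact: big_morph. Qed.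

End Bicommutant.

(** * Pushing labels forward *)

Section Push.
Variables (k : fieldType) (A : comPzRingType) (eta : {rmorphism k -> A}).
Variable X : pointed_fin_sset.
Implicit Types m n l : nat.

(** A label lost in the inner push-forward, because [q] sends its simplex to the
    base point, is also lost on the left as [p] preserves the base point. *)
Lemma push_comp l m n (p : X m -> X n) (q : X l -> X m)
    (a : {ffun nbcell X l -> alg_space eta}) :
  p (basept X m) = basept X n -> push p (push q a) = push (p \o q) a.
Proof.
move=> p0; apply/ffunP => y; rewrite !ffunE.
under eq_bigr do rewrite ffunE.
rewrite (exchange_big_dep (fun x => p (q (val x)) == val y)) /=; last first.
  by move=> z x /eqP pz /eqP qx; rewrite qx pz.
apply: eq_bigr => x /eqP pqx.
have nqx : q (val x) != basept X m.
  by apply/eqP => qx; case/eqP: (valP y); rewrite /= -pqx qx.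
rewrite (big_pred1 (exist _ (q (val x)) nqx)) // => z /=.
rewrite -val_eqE /= [RHS]eq_sym.
by case: (q (val x) =P val z) => [<-|_]; rewrite ?andbF ?pqx ?eqxx.
Qed.

Lemma push_id n (p : X n -> X n) (a : {ffun nbcell X n -> alg_space eta}) :
  p =1 id -> push p a = a.
Proof.
move=> pid; apply/ffunP => y; rewrite ffunE (big_pred1 y) // => x.
by rewrite pid val_eqE.
Qed.

Lemma eq_push m n (p q : X m -> X n) (a : {ffun nbcell X m -> alg_space eta}) :
  p =1 q -> push p a = push q a.
Proof. by move=> /funext ->. Qed.

End Push.

(** * Actions of single labels *)

Section Act.
Variables (k : fieldType) (A : comPzRingType) (eta : {rmorphism k -> A}).
Variables (X : pointed_fin_sset) (M : lmodType k).
Variable L : forall n (i : 'I_n.+2) (x : nbcell X n.+1),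
  face i (val x) = basept X n -> module_structure eta M.

Definition is_action (f : M -> M) : Prop :=
  exists n (i : 'I_n.+2) (x : nbcell X n.+1) (h : face i (val x) = basept X n)
    (a : A), f = L h a.

Hypothesis L_commute : forall f g, is_action f -> is_action g ->
  f \o g = g \o f.

Definition actions : commuting_set M := CommutingSet L_commute.

Local Notation "1" := (bi1 actions) : ring_scope.
Local Notation "f * g" := (bimul f g) : ring_scope.

Fact op_subproof n (i : 'I_n.+2) (x : nbcell X n.+1)
    (h : face i (val x) = basept X n) (a : A) :
  centralizes (centralizes actions) (L h a).
Proof. by apply: in_bicommutant; exists n, i, x, h, a. Qed.

Definition op n (i : 'I_n.+2) (x : nbcell X n.+1)
    (h : face i (val x) = basept X n) (a : A) : bicommutant actions :=
  Bicommutant (op_subproof h a).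

Lemma op_prod n (i : 'I_n.+2) (x : nbcell X n.+1)
    (h : face i (val x) = basept X n) (I : finType) (P : pred I) (F : I -> A) :
  op h (\prod_(y | P y) F y)%R = \big[@bimul _ _/1]_(y | P y) op h (F y).
Proof.
apply: (big_morph (op h)) => [a b|]; apply/bival_inj/funext => m /=.
  by rewrite mod_actA.
by rewrite mod_act1.
Qed.

Section Face.
Variables (n : nat) (i : 'I_n.+2).
Local Notation swept :=
  {x : nbcell X n.+1 | face i (val x) == basept X n}.

(** The product has at most one factor, so that this is the action [L] on the
    simplex [z] if [z] is not the base point but [d_i z] is, and the identity
    otherwise.  Allowing every [z] avoids case distinctions. *)
Definition act (z : X n.+1) (a : A) : bicommutant actions :=
  \big[@bimul _ _/1]_(y : swept | z == val (val y)) op (eqP (valP y)) a.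

Lemma act_op (x : nbcell X n.+1) (h : face i (val x) = basept X n) a :
  act (val x) a = op h a.
Proof.
pose y : swept := Sub x (introT eqP h).
rewrite /act (big_pred1 y) => [|z]; last by rewrite /= eq_sym !val_eqE.
by congr op; apply: eq_irrelevance.
Qed.

Lemma act_basept a : act (basept X n.+1) a = 1.
Proof.
by rewrite /act big_pred0 // => y; rewrite eq_sym (negPf (valP (val y))).
Qed.

Lemma act_face_neq z a : face i z != basept X n -> act z a = 1.
Proof.
move=> nz; rewrite /act big_pred0 // => y; apply/eqP => zy.
by move: nz; rewrite zy (valP y).
Qed.

(** The action of a product of labels over a fibre of [p] is the composite of
    the actions of these labels, as actions are multiplicative; regrouping the
    composite by simplices of the source of [p] uses that actions commute. *)
Lemma act_prod_push m (p : X m -> X n.+1)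
    (a : {ffun nbcell X m -> alg_space eta}) :
  act_prod L i (push p a) =
    bival (\big[@bimul _ _/1]_(x : nbcell X m) act (p (val x)) (a x)).
Proof.
rewrite (exchange_big_dep predT) //= bival_prod.
apply: eq_bigr => y _; rewrite -op_prod /=.
by congr (L _ _); rewrite ffunE.
Qed.

Lemma act_prodE (a : {ffun nbcell X n.+1 -> alg_space eta}) :
  act_prod L i a =
    bival (\big[@bimul _ _/1]_(x : nbcell X n.+1) act (val x) (a x)).
Proof. by rewrite -{1}(@push_id _ _ _ _ _ id a) // act_prod_push. Qed.

End Face.

Hypothesis sweep_around : forall (n : nat) (i j : 'I_n.+3)
    (sigma : nbcell X n.+2)
    (hi : face i (val sigma) = basept X n.+1)
    (hj : face j (val sigma) = basept X n.+1),
  (i < j)%N -> mod_act (L hj) =2 mod_act (L hi).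
Hypothesis sweep_out1 : forall (n : nat) (i j : 'I_n.+3)
    (sigma : nbcell X n.+2) (Omega : nbcell X n.+1)
    (hj : face j (val sigma) = basept X n.+1)
    (hO : face (inord j.-1) (val Omega) = basept X n),
  (i < j)%N -> face i (val sigma) = val Omega ->
  mod_act (L hj) =2 mod_act (L hO).
Hypothesis sweep_across : forall (n : nat) (i j : 'I_n.+3)
    (sigma : nbcell X n.+2) (Omega mu : nbcell X n.+1)
    (hO : face (inord i) (val Omega) = basept X n)
    (hmu : face (inord j.-1) (val mu) = basept X n),
  (i < j)%N -> face j (val sigma) = val Omega -> face i (val sigma) = val mu ->
  mod_act (L hO) =2 mod_act (L hmu).
Hypothesis sweep_out2 : forall (n : nat) (i j : 'I_n.+3)
    (sigma : nbcell X n.+2) (Omega : nbcell X n.+1)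
    (hi : face i (val sigma) = basept X n.+1)
    (hO : face (inord i) (val Omega) = basept X n),
  (i < j)%N -> face j (val sigma) = val Omega ->
  mod_act (L hO) =2 mod_act (L hi).

Lemma op_congr m n (i : 'I_m.+2) (j : 'I_n.+2) (x : nbcell X m.+1)
    (y : nbcell X n.+1) (hx : face i (val x) = basept X m)
    (hy : face j (val y) = basept X n) a :
  mod_act (L hx) =2 mod_act (L hy) -> op hx a = op hy a.
Proof. by move=> e; apply/bival_inj/funext/e. Qed.

(** The contributions of the simplex [x] to the two sides of
    [d^j d^i = d^i d^(j-1)] agree.  Each of the four sweep conditions settles
    one of the cases in which a contribution differs from the identity. *)
Lemma act_sweep n (i j : 'I_n.+3) (x : nbcell X n.+2) a : (i < j)%N ->
  act j (val x) a * act (inord i) (face j (val x)) a =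
  act i (val x) a * act (inord j.-1) (face i (val x)) a.
Proof.
move=> ij; have fxx := face_face (val x) ij.
have [hj|nj] := eqVneq (face j (val x)) (basept X n.+1);
  have [hi|ni] := eqVneq (face i (val x)) (basept X n.+1).
- rewrite hi hj !act_basept (act_op hi) (act_op hj).
  by rewrite (op_congr _ (sweep_around hi hj ij)).
- pose O : nbcell X n.+1 := exist (fun z => z != basept X n.+1) _ ni.
  have hO : face (inord j.-1) (val O) = basept X n.
    by rewrite /= -fxx hj face_basept.
  rewrite hj act_basept (act_face_neq _ ni) (act_op hj) -[face i _]/(val O).
  by rewrite (act_op hO) bimulC (op_congr _ (sweep_out1 hj hO ij erefl)).
- pose O : nbcell X n.+1 := exist (fun z => z != basept X n.+1) _ nj.
  have hO : face (inord i) (val O) = basept X n.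
    by rewrite /= fxx hi face_basept.
  rewrite hi act_basept (act_face_neq _ nj) (act_op hi) -[face j _]/(val O).
  by rewrite (act_op hO) bimulC (op_congr _ (sweep_out2 hi hO ij erefl)).
rewrite (act_face_neq _ ni) (act_face_neq _ nj) !bimul1.
pose O : nbcell X n.+1 := exist (fun z => z != basept X n.+1) _ nj.
pose mu : nbcell X n.+1 := exist (fun z => z != basept X n.+1) _ ni.
have [h|nh] := eqVneq (face (inord i) (face j (val x))) (basept X n).
  have hmu : face (inord j.-1) (val mu) = basept X n by rewrite /= -fxx.
  rewrite -[face j _]/(val O) -[face i _]/(val mu) (act_op hmu).
  by rewrite (act_op (h : face _ (val O) = _)); apply/op_congr/sweep_across.
by rewrite !act_face_neq // -fxx.
Qed.

(** The simplex [s_j x] is not the base point and has [x] as its [j]-th face, and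
    its [i]-th face is the base point exactly when [d_(i-1) x] is: sweeping out
    replaces its action by that of [x]. *)
Lemma act_degen_gt n (i : 'I_n.+3) (j : 'I_n.+2) (x : nbcell X n.+1) a :
  (j.+1 < i)%N -> act i (degen j (val x)) a = act (inord i.-1) (val x) a.
Proof.
move=> ji; have fd := face_degen_gt (val x) ji.
pose y : nbcell X n.+2 :=
  exist (fun z => z != basept X n.+2) _ (degen_nbcell j x).
pose j' : 'I_n.+3 := inord j.
have j'j : j' = j :> nat by rewrite inordK // ltnW // ltnS.
have fy : face j' (val y) = val x by apply: face_degen_id; left.
have [h|nh] := eqVneq (face (inord i.-1) (val x)) (basept X n).
  have hy : face i (val y) = basept X n.+1 by rewrite /= fd h degen_basept.
  rewrite (act_op h) -[degen j _]/(val y) (act_op hy).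
  by apply/op_congr/(sweep_out1 (i := j')); rewrite ?j'j // ltnW.
rewrite !act_face_neq // fd.
exact: (degen_nbcell _ (exist (fun z => z != basept X n) _ nh)).
Qed.

Lemma act_degen_lt n (i : 'I_n.+3) (j : 'I_n.+2) (x : nbcell X n.+1) a :
  (i < j)%N -> act i (degen j (val x)) a = act (inord i) (val x) a.
Proof.
move=> ij; have fd := face_degen_lt (val x) ij.
pose y : nbcell X n.+2 :=
  exist (fun z => z != basept X n.+2) _ (degen_nbcell j x).
pose j' : 'I_n.+3 := inord j.
have j'j : j' = j :> nat by rewrite inordK // ltnW // ltnS.
have fy : face j' (val y) = val x by apply: face_degen_id; left.
have [h|nh] := eqVneq (face (inord i) (val x)) (basept X n).
  have hy : face i (val y) = basept X n.+1 by rewrite /= fd h degen_basept.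
  rewrite (act_op h) -[degen j _]/(val y) (act_op hy).
  by apply/esym/op_congr/(sweep_out2 (j := j')); rewrite ?j'j.
rewrite !act_face_neq // fd.
exact: (degen_nbcell _ (exist (fun z => z != basept X n) _ nh)).
Qed.

Lemma act_degen_id n (i : 'I_n.+2) (j : 'I_n.+1) (x : nbcell X n) a :
  i = j :> nat \/ i = j.+1 :> nat -> act i (degen j (val x)) a = 1.
Proof.
by move=> ij; rewrite act_face_neq // face_degen_id //; apply: (valP x).
Qed.

(** * The cosimplicial identities *)

Lemma coface_is_linear n (i : 'I_n.+2) : linear (coface L i).
Proof.
move=> c f g; apply: MX_ext => a.
by rewrite Hom_linE !cofaceE Hom_linE act_prod_linear.
Qed.

Lemma MX_coface_coface n (i j : 'I_n.+3) (f : MX eta X M n) : (i < j)%N ->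
  coface L j (coface L (inord i) f) = coface L i (coface L (inord j.-1) f).
Proof.
move=> ij; apply: MX_ext => a; rewrite !cofaceE !push_comp ?face_basept //.
rewrite (eq_push (q := face (inord j.-1) \o face i)); last first.
  by move=> x; apply: face_face.
set m := f _; rewrite !act_prod_push !act_prodE.
(* On each side, two coface actions applied in succession are one element of the
   bicommutant, so that their products over simplices can be merged. *)
rewrite -[LHS]/(bival (_ * _) m) -[RHS]/(bival (_ * _) m) -!big_split.
by congr (bival _ m); apply: eq_bigr => x _; apply: act_sweep.
Qed.

Lemma MX_codegen_coface_lt n (i : 'I_n.+3) (j : 'I_n.+2)
    (f : MX eta X M n.+1) : (i < j)%N ->
  codegen j (coface L i f) = coface L (inord i) (codegen (inord j.-1) f).
Proof.
move=> ij; apply: MX_ext => a; rewrite codegenE !cofaceE codegenE.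
rewrite !push_comp ?face_basept ?degen_basept //.
rewrite (eq_push (q := degen (inord j.-1) \o face (inord i))); last first.
  by move=> x; apply: face_degen_lt.
set m := f _; rewrite act_prod_push act_prodE; congr (bival _ m).
by apply: eq_bigr => x _; apply: act_degen_lt.
Qed.

Lemma MX_codegen_coface_gt n (i : 'I_n.+3) (j : 'I_n.+2)
    (f : MX eta X M n.+1) : (j.+1 < i)%N ->
  codegen j (coface L i f) = coface L (inord i.-1) (codegen (inord j) f).
Proof.
move=> ji; apply: MX_ext => a; rewrite codegenE !cofaceE codegenE.
rewrite !push_comp ?face_basept ?degen_basept //.
rewrite (eq_push (q := degen (inord j) \o face (inord i.-1))); last first.
  by move=> x; apply: face_degen_gt.
set m := f _; rewrite act_prod_push act_prodE; congr (bival _ m).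
by apply: eq_bigr => x _; apply: act_degen_gt.
Qed.

Lemma MX_codegen_coface_id n (i : 'I_n.+2) (j : 'I_n.+1) (f : MX eta X M n) :
  i = j :> nat \/ i = j.+1 :> nat -> codegen j (coface L i f) = f.
Proof.
move=> ij; apply: MX_ext => a; rewrite codegenE cofaceE.
rewrite push_comp ?face_basept // push_id => [|x]; last exact: face_degen_id.
by rewrite act_prod_push big1 // => x _; apply: act_degen_id.
Qed.

End Act.

Section Codegeneracies.
Variables (k : fieldType) (A : comPzRingType) (eta : {rmorphism k -> A}).
Variables (X : pointed_fin_sset) (M : lmodType k).

Lemma codegen_is_linear n (i : 'I_n.+1) : linear (@codegen k A eta X M n i).
Proof. by move=> c f g; apply: MX_ext => a; rewrite Hom_linE !codegenE. Qed.

Lemma MX_codegen_codegen n (i j : 'I_n.+2) (f : MX eta X M n.+2) : (j < i)%N ->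
  codegen (inord j) (codegen i f) = codegen (inord i.-1) (codegen j f).
Proof.
move=> ji; apply: MX_ext => a; rewrite !codegenE !push_comp ?degen_basept //.
congr (f (pureX _)); apply: eq_push => x /=.
have jn : (j < n.+1)%N by rewrite (leq_trans ji) // -ltnS.
have in1 : (i.-1 < n.+1)%N by rewrite prednK ?(leq_ltn_trans _ ji) // -ltnS.
have := @degen_degen X n (inord j) (inord i.-1) x.
rewrite !inordK // prednK ?(leq_ltn_trans _ ji) // !inord_val => -> //.
by rewrite -ltnS prednK ?(leq_ltn_trans _ ji).
Qed.

End Codegeneracies.

Theorem theorem1p1 (k : fieldType) (A : comPzRingType)
    (eta : {rmorphism k -> A}) (X : pointed_fin_sset) (M : lmodType k)
    (L : forall (n : nat) (i : 'I_n.+2) (sigma : nbcell X n.+1),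
      face i (val sigma) = basept X n -> module_structure eta M)
    (L_commute : forall (n : nat) (i : 'I_n.+2) (sigma : nbcell X n.+1)
        (hi : face i (val sigma) = basept X n)
        (m : nat) (j : 'I_m.+2) (tau : nbcell X m.+1)
        (hj : face j (val tau) = basept X m) (a b : A) (x : M),
      L n i sigma hi a (L m j tau hj b x) = L m j tau hj b (L n i sigma hi a x))
    (sweep_around : forall (n : nat) (i j : 'I_n.+3) (sigma : nbcell X n.+2)
        (hi : face i (val sigma) = basept X n.+1)
        (hj : face j (val sigma) = basept X n.+1),
      (i < j)%N ->
      mod_act (L n.+1 j sigma hj) =2 mod_act (L n.+1 i sigma hi))
    (sweep_out1 : forall (n : nat) (i j : 'I_n.+3) (sigma : nbcell X n.+2)
        (Omega : nbcell X n.+1)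
        (hj : face j (val sigma) = basept X n.+1)
        (hO : face (inord j.-1) (val Omega) = basept X n),
      (i < j)%N -> face i (val sigma) = val Omega ->
      mod_act (L n.+1 j sigma hj) =2 mod_act (L n (inord j.-1) Omega hO))
    (sweep_across : forall (n : nat) (i j : 'I_n.+3) (sigma : nbcell X n.+2)
        (Omega mu : nbcell X n.+1)
        (hO : face (inord i) (val Omega) = basept X n)
        (hmu : face (inord j.-1) (val mu) = basept X n),
      (i < j)%N -> face j (val sigma) = val Omega ->
      face i (val sigma) = val mu ->
      mod_act (L n (inord i) Omega hO) =2 mod_act (L n (inord j.-1) mu hmu))
    (sweep_out2 : forall (n : nat) (i j : 'I_n.+3) (sigma : nbcell X n.+2)
        (Omega : nbcell X n.+1)
        (hi : face i (val sigma) = basept X n.+1)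
        (hO : face (inord i) (val Omega) = basept X n),
      (i < j)%N -> face j (val sigma) = val Omega ->
      mod_act (L n (inord i) Omega hO) =2 mod_act (L n.+1 i sigma hi)) :
  is_cosimplicial (C := MX eta X M) (fun n => coface L (n := n))
    (fun n => codegen (n := n)).
Proof.
have Lc f g : is_action L f -> is_action L g -> f \o g = g \o f.
  move=> [n [i [x [h [a ->]]]]] [m [j [y [h' [b ->]]]]].
  by apply/funext => v /=; rewrite L_commute.
split.
- by move=> n i; apply: coface_is_linear.
- by move=> n i; apply: codegen_is_linear.
- exact: (MX_coface_coface Lc).
- by move=> n i j f; apply: MX_codegen_codegen.
- exact: (MX_codegen_coface_lt Lc).
- exact: (MX_codegen_coface_id Lc).
- exact: (MX_codegen_coface_gt Lc).
Qed.
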